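(* Let $H$ be a graph with $e(H)\geq 2$ and no isolated vertices. If $H$ is $2$-connected then $\mathrm{sat_p}(H,H[n])=\Theta(n)$, and if $H$ is not $2$-connected then $\mathrm{sat_p}(H,H[n])=\Theta(n^2)$. Here $H$ is fixed, $n\to\infty$, and the implied constants may depend on $H$.
   Context: Graphs are finite and simple. A graph is $2$-connected if after the removal of any single vertex it is still connected. For a graph $H$ and $n\in\mathbb{N}$, $H[n]$ is the graph obtained from $H$ by replacing each vertex with an independent set (a part) of size $n$ and each edge with a complete bipartite graph between the corresponding parts. A copy of $H$ in $H[n]$ is partite if it has exactly one vertex in each part of $H[n]$. A spanning subgraph $G\subseteq H[n]$ is $H$-partite-free if it contains no partite copy of $H$. $G$ is $(H,H[n])$-partite-saturated if $G$ is $H$-partite-free but for every edge $uv\in E(H[n])\setminus E(G)$ the graph $G\cup uv$ contains a partite copy of $H$. $\mathrm{sat_p}(H,H[n])$ is the minimum of $e(G)$ over all $(H,H[n])$-partite-saturated graphs $G$. *)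

(* Defs.v *)
From mathcomp Require Import all_boot.

Set Implicit Arguments.
Unset Strict Implicit.
Unset Printing Implicit Defensive.

(* A graph whose vertex set is the whole finite type T is given by its edge
   set E : {set {set T}}; e(E) is then #|E|, and a spanning subgraph of E is a
   subset of E. *)

Definition simple_graph (T : finType) (E : {set {set T}}) : Prop :=
  forall A, A \in E -> #|A| = 2.

Definition adj (T : finType) (E : {set {set T}}) : rel T :=
  [rel x y | [set x; y] \in E].

Definition no_isolated_vertex (T : finType) (E : {set {set T}}) : Prop :=
  forall x, exists y, adj E x y.

Definition connected_graph (T : finType) (S : {set T}) (E : {set {set T}}) :
  bool := [forall x in S, forall y in S, connect (adj E) x y].

Definition delete_vertex (T : finType) (E : {set {set T}}) (z : T) :
  {set {set T}} := [set A in E | z \notin A].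

Definition two_connected (T : finType) (E : {set {set T}}) : bool :=
  [forall z, connected_graph [set~ z] (delete_vertex E z)].

(* H[n]; its part corresponding to v is the set of pairs (v, i), i < n. *)
Definition blowup (V : finType) (H : {set {set V}}) (n : nat) :
  {set {set V * 'I_n}} :=
  [set [set a; b] | a, b in [set: V * 'I_n] & adj H a.1 b.1].

(* f embeds H in G as a not necessarily induced subgraph; the vertex x of H
   need not be sent to the part of x. *)
Definition is_copy (V T : finType) (H : {set {set V}}) (G : {set {set T}})
  (f : {ffun V -> T}) : bool :=
  injectiveb f && [forall x, forall y, adj H x y ==> adj G (f x) (f y)].

Definition is_partite (V : finType) (n : nat) (f : {ffun V -> V * 'I_n}) :
  bool := [forall v, #|[set a in codom f | a.1 == v]| == 1].

Definition partite_free (V : finType) (H : {set {set V}}) (n : nat)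
  (G : {set {set V * 'I_n}}) : bool :=
  ~~ [exists f : {ffun V -> V * 'I_n}, is_copy H G f && is_partite f].

Definition partite_saturated (V : finType) (H : {set {set V}}) (n : nat)
  (G : {set {set V * 'I_n}}) : bool :=
  [&& G \subset blowup H n, partite_free H G &
      [forall A in blowup H n :\: G, ~~ partite_free H (A |: G)]].

(* Every subgraph of H[n] has at most #|blowup H n| edges, so this is the
   minimum as soon as a saturated graph exists; see sat_pP. *)
Definition sat_p (V : finType) (H : {set {set V}}) (n : nat) : nat :=
  \big[minn/#|blowup H n|]_(G : {set {set V * 'I_n}} | partite_saturated H G)
    #|G|.

Lemma partite_saturated_exists (V : finType) (H : {set {set V}}) (n : nat) :
  simple_graph H -> 0 < #|H| ->
  exists G : {set {set V * 'I_n}}, partite_saturated H G.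
Proof.
move=> Hs /card_gt0P[A AH].
have /eqP/cards2P[x [y [_ eA]]] := Hs _ AH.
pose P (G : {set {set V * 'I_n}}) := (G \subset blowup H n) && partite_free H G.
have P0 : P set0.
  rewrite /P sub0set /=; apply/existsPn => f; apply/negP => /andP[/andP[_]].
  by move=> /forallP/(_ x)/forallP/(_ y); rewrite /adj /= -eA AH in_set0.
have [G /maxsetP[/andP[sG fG] maxG] _] := maxset_exists P0.
exists G; rewrite /partite_saturated sG fG /=.
apply/forall_inP => B; rewrite inE => /andP[BG BH]; apply/negP => fBG.
have := maxG (B |: G); rewrite /P fBG andbT subUset sub1set BH sG subsetUr.
by move=> /(_ isT isT) eG; move: BG; rewrite -eG setU11.
Qed.

Lemma sat_p_le (V : finType) (H : {set {set V}}) (n : nat)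
  (G : {set {set V * 'I_n}}) : partite_saturated H G -> sat_p H n <= #|G|.
Proof.
move=> sG; rewrite /sat_p; have := mem_index_enum G.
elim: (index_enum _) => // B s IHs; rewrite inE big_cons => /orP[/eqP<-|/IHs les].
  by rewrite sG geq_minl.
by case: ifP => // _; apply: leq_trans les; apply: geq_minr.
Qed.

Lemma sat_pP (V : finType) (H : {set {set V}}) (n : nat) :
  simple_graph H -> 0 < #|H| ->
  (exists2 G : {set {set V * 'I_n}}, partite_saturated H G & #|G| = sat_p H n)
  /\ (forall G : {set {set V * 'I_n}},
        partite_saturated H G -> sat_p H n <= #|G|).
Proof.
move=> Hs H0; split; last exact: sat_p_le.
have [G0 sG0] := partite_saturated_exists n Hs H0.
case: (@arg_minnP _ G0 (@partite_saturated V H n) (fun G => #|G|) sG0) => G sG minG.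
exists G => //; apply/eqP; rewrite eqn_leq (sat_p_le sG) andbT /sat_p.
elim/big_ind: _ => [|a b ha hb|B /minG//]; last by rewrite leq_min ha hb.
by apply: subset_leq_card; case/and3P: sG.
Qed.

(* Main.v *)
Require Import Defs.
From mathcomp Require Import all_boot all_order all_algebra.
From mathcomp Require Import all_classical reals topology normedtype landau.
Import Order.TTheory GRing.Theory Num.Theory.
Import numFieldNormedType.Exports.

(** A partite copy of [H] may permute the parts, but then it permutes them by
    an automorphism of [H]; so [G] contains a partite copy iff it contains the
    image of some transversal [v |-> (v, t v)] ([partite_freeP]). If an edge
    over [xy] is missing from a saturated [G], adding it produces a transversal
    through its two ends all of whose other edges are in [G]
    ([saturated_missing]). Everything below is read off from this.

    Lower bound [n ^ 2], [H] not 2-connected. Say that [z] is a cut vertex.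
    Two transversals obtained from missing edges at the same [(z, i)], one on
    each side of [z], can be cut at [z] and glued into a copy inside [G]; so
    each [(z, i)] is joined to a whole part. A disconnected [H] is handled in
    the same way, with nothing shared by the two sides
    ([saturated_gluing], [not_two_connected_bound]). The matching upper bound
    is the number of edges of the blow-up.

    Lower bound [n], [H] 2-connected. All degrees in [H] are at least two, so
    no vertex of [G] is isolated ([two_connected_bound]).

    Upper bound [O(n)], [H] 2-connected. Reserve a bounded number of layers
    of the blow-up, one layer for each edge [e = xy] of [H], and call the
    remaining vertices outer. Put into the layer of [e] a copy of [H - {x, y}]
    and join it to all outer vertices of the parts [x] and [y] in such a way
    that any outer edge over [xy] would complete a copy of [H]. Then no
    saturated graph containing this gadget has an edge between outer vertices,
    so it has only [O(n)] edges. What must be shown is that the gadget itself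
    contains no copy ([gadget_free]). The outer vertices of a copy are
    independent; the other ones in the layer of [e] have only [x] and [y] as
    outer neighbours. As [H] is 2-connected, they cannot be cut off from
    [x] by deleting [y], nor from [y] by deleting [x], which forces both [x]
    and [y] to be outer. But [xy] is an edge of [H]. *)

Set Implicit Arguments.
Unset Strict Implicit.
Unset Printing Implicit Defensive.

(** * Adjacency and blow-ups *)

Lemma set2_inj (T : finType) (a b c d : T) :
  [set a; b] = [set c; d] -> (a = c /\ b = d) \/ (a = d /\ b = c).
Proof.
move=> e.
have /set2P aP : a \in [set c; d] by rewrite -e set21.
have /set2P bP : b \in [set c; d] by rewrite -e set22.
have /set2P cP : c \in [set a; b] by rewrite e set21.
have /set2P dP : d \in [set a; b] by rewrite e set22.
by case: aP; case: bP; case: cP; case: dP; intuition congruence.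
Qed.

Lemma adjE (T : finType) (E : {set {set T}}) x y :
  adj E x y = ([set x; y] \in E).
Proof. by []. Qed.

Lemma adj_sym (T : finType) (E : {set {set T}}) : symmetric (adj E).
Proof. by move=> x y; rewrite adjE finset.setUC. Qed.

Lemma adj_neq (T : finType) (E : {set {set T}}) x y :
  simple_graph E -> adj E x y -> x != y.
Proof. by move=> sE /sE; rewrite cards2; case: (x != y). Qed.

Lemma adj_edge (T : finType) (E : {set {set T}}) (A : {set T}) :
  simple_graph E -> A \in E -> exists x y, A = [set x; y] /\ adj E x y.
Proof.
move=> sE AE; have /eqP/cards2P[x [y [_ eA]]] := sE _ AE.
by exists x, y; split=> //; rewrite adjE -eA.
Qed.

Lemma adj_delete (T : finType) (E : {set {set T}}) (z x y : T) :
  adj (delete_vertex E z) x y = [&& adj E x y, z != x & z != y].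
Proof. by rewrite adjE !inE negb_or. Qed.

Lemma adj_blowup (V : finType) (H : {set {set V}}) n (a b : V * 'I_n) :
  adj (blowup H n) a b = adj H a.1 b.1.
Proof.
apply/imset2P/idP => [[c d _ /[!inE]/= cd /set2_inj[[-> ->]|[-> ->]]]|ab] //.
  by rewrite adj_sym.
by exists a b; rewrite ?inE.
Qed.

Lemma card_blowup (V : finType) (H : {set {set V}}) n :
  #|blowup H n| <= (#|V| ^ 2) * (n ^ 2).
Proof.
pose e (p : (V * 'I_n) * (V * 'I_n)) := [set p.1; p.2].
have /subset_leq_card : blowup H n \subset [set e p | p in predT].
  by apply/fintype.subsetP => _ /imset2P[a b _ _ ->]; apply/imsetP; exists (a, b).
move/leq_trans; apply; apply: leq_trans (leq_imset_card _ _) _.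
by rewrite !card_prod card_ord -expnMn mulnn.
Qed.

(** * Partite copies as transversals *)

Definition transversal_copy (V : finType) (H : {set {set V}}) n
  (G : {set {set V * 'I_n}}) (t : V -> 'I_n) : Prop :=
  forall x y, adj H x y -> adj G (x, t x) (y, t y).

(** The permutation of the parts induced by a partite copy is an automorphism
    of [H], and composing with its inverse straightens the copy. *)
Lemma partite_freeP (V : finType) (H : {set {set V}}) n
    (G : {set {set V * 'I_n}}) :
  simple_graph H -> G \subset blowup H n ->
  reflect (forall t, ~ transversal_copy H G t) (partite_free H G).
Proof.
move=> sH sG; apply: (iffP idP) => [/existsPn fG t tG | noG].
  pose f := [ffun v => (v, t v)].
  have /negP := fG f; apply; apply/andP; split; first (apply/andP; split).
  - by apply/injectiveP => u v; rewrite !ffunE => -[].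
  - apply/forallP => x; apply/forallP => y; apply/implyP => xy.
    by rewrite !ffunE tG.
  - apply/forallP => v; apply/cards1P; exists (v, t v); apply/finset.setP => a.
    rewrite !inE; apply/andP/eqP => [[/codomP[u ->]]|->].
      by rewrite ffunE /= => /eqP->.
    by split=> //; apply/codomP; exists v; rewrite ffunE.
apply/existsPn => f; apply/negP.
move=> /andP[/andP[/injectiveP injf /forallP cf] /forallP pf].
pose s v := (f v).1.
have injs : injective s.
  move=> u v suv; have /cards1P[a ea] := pf (s v).
  apply: injf; transitivity a.
    by apply/set1P; rewrite -ea inE codom_f /= -/(s u) suv.
  by apply/esym/set1P; rewrite -ea inE codom_f /=.
have sadj u v : adj H u v -> adj H (s u) (s v).
  move=> uv; have /forallP/(_ v)/implyP/(_ uv) := cf u.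
  by move=> /(fintype.subsetP sG); rewrite -adjE adj_blowup.
(* An injective endomorphism of a finite graph permutes its edges, hence its
   inverse is an endomorphism too. *)
have imH : [set s @: (A : {set V}) | A in H] = H.
  apply/eqP; rewrite eqEcard (card_imset _ (imset_inj injs)) leqnn andbT.
  apply/fintype.subsetP => _ /imsetP[A /(adj_edge sH)[x [y [-> xy]]] ->].
  by rewrite imsetU1 imset_set1; apply: sadj.
pose r := invF injs.
have radj u v : adj H u v -> adj H (r u) (r v).
  have uvE : [set u; v] = s @: [set r u; r v].
    by rewrite imsetU !imset_set1 !f_invF.
  by rewrite adjE -{1}imH uvE => /imsetP[B BH /(imset_inj injs)]; rewrite adjE => ->.
have fr v : (v, (f (r v)).2) = f (r v).
  by rewrite [RHS]surjective_pairing -/(s _) f_invF.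
apply: (noG (fun v => (f (r v)).2)) => x y /radj xy; rewrite !fr.
by have /forallP/(_ (r y))/implyP/(_ xy) := cf (r x).
Qed.

Lemma saturated_extension (V : finType) (H : {set {set V}}) n
    (G0 : {set {set V * 'I_n}}) :
  G0 \subset blowup H n -> partite_free H G0 ->
  exists2 G : {set {set V * 'I_n}}, partite_saturated H G & G0 \subset G.
Proof.
move=> s0 f0.
pose P (G : {set {set V * 'I_n}}) := (G \subset blowup H n) && partite_free H G.
have [G /maxsetP[/andP[sG fG] maxG] G0G] := @maxset_exists _ P G0 (introT andP (conj s0 f0)).
exists G => //; rewrite /partite_saturated sG fG /=.
apply/forall_inP => B; rewrite inE => /andP[/negP BG BH]; apply/negP => fBG.
by apply: BG; rewrite -(maxG (B |: G)) ?setU11 ?finset.subsetUr // /P fBG finset.subUset finset.sub1set BH sG.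
Qed.

(** * Lower bounds *)

Section Saturated.

Variables (V : finType) (H : {set {set V}}) (n : nat).
Variable G : {set {set V * 'I_n}}.
Hypotheses (H_simple : simple_graph H) (G_sat : partite_saturated H G).

(** The copy created by the new edge must use it, and it is the only edge of
    that copy lying over [xy]. *)
Lemma saturated_missing x y i j :
  adj H x y -> ~~ adj G (x, i) (y, j) ->
  exists t : V -> 'I_n, [/\ t x = i, t y = j & forall u v, adj H u v ->
    [set u; v] != [set x; y] -> adj G (u, t u) (v, t v)].
Proof.
move=> xy nG; have /and3P[sG fG /forall_inP satG] := G_sat.
pose e := [set (x, i); (y, j)].
have eB : e \in blowup H n by rewrite -adjE adj_blowup.
have sGe : e |: G \subset blowup H n by rewrite finset.subUset finset.sub1set eB sG.
have : ~~ `[< forall t, ~ transversal_copy H (e |: G) t >].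
  apply: contra (satG e _) => [/asboolP free|]; first exact/partite_freeP.
  by rewrite inE nG.
move=> /existsp_asboolPn[t /contrapT tG]; exists t.
have xye u v : [set (u, t u); (v, t v)] = e ->
    [/\ t x = i, t y = j & [set u; v] = [set x; y]].
  case/set2_inj => [[[-> <-] [-> <-]]|[[-> <-] [-> <-]]] //.
  by rewrite finset.setUC.
have [tx ty] : t x = i /\ t y = j.
  apply: contrapT => nt; apply: (partite_freeP H_simple sG fG t) => u v uv.
  have := tG u v uv; rewrite {1}adjE !inE => /orP[/eqP/xye[tx ty _]|//].
  by case: nt.
split=> // u v uv nuv; have := tG u v uv.
by rewrite {1}adjE !inE => /orP[/eqP/xye[_ _ /eqP]|//]; rewrite (negPf nuv).
Qed.

(** Two transversals that agree on the overlap of [X] and [Y] glue together.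
    If both edges were missing, each would come with such a transversal, and
    each missing edge lies over the side where the other transversal is used,
    so that the glued one would be a copy inside [G] itself. *)
Lemma saturated_gluing (X Y : {set V}) x y x' y' i j i' j' :
  (forall u v, adj H u v -> (u \in X) && (v \in X) || (u \in Y) && (v \in Y)) ->
  (forall w, w \in X -> w \in Y -> [/\ w = x, w = x' & i = i']) ->
  adj H x y -> y \notin Y -> adj H x' y' -> y' \notin X ->
  adj G (x, i) (y, j) || adj G (x', i') (y', j').
Proof.
move=> XY ov xy yY xy' yX'; apply/norP => -[n1 n2].
have [t1 [t1x _ t1G]] := saturated_missing xy n1.
have [t2 [t2x _ t2G]] := saturated_missing xy' n2.
have /and3P[sG fG _] := G_sat.
pose t w := if w \in Y then t1 w else t2 w.
apply: (partite_freeP H_simple sG fG t) => u v uv.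
have [/andP[uY vY]|nY] := boolP ((u \in Y) && (v \in Y)).
  rewrite /t uY vY; apply: t1G => //; apply: contraNneq yY => e.
  by have := set22 x y; rewrite -e => /set2P[]->.
have := XY u v uv; rewrite (negPf nY) orbF => /andP[uX vX].
have tX w : w \in X -> t w = t2 w.
  rewrite /t; case: ifP => // wY wX.
  by have [ex ex' ei] := ov w wX wY; rewrite {1}ex ex' t1x t2x ei.
rewrite !tX //; apply: t2G => //; apply: contraNneq yX' => e.
by have := set22 x' y'; rewrite -e => /set2P[]->.
Qed.

(** Each edge of a graph in the blow-up meets a given part at most once, so
    the degrees inside one part add up without double counting. *)
Lemma part_degree_bound z d :
  (forall i, exists f : 'I_d -> V * 'I_n,
     injective f /\ forall k, adj G (z, i) (f k)) ->
  n * d <= #|G|.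
Proof.
case/choice=> f fP; have /and3P[sG _ _] := G_sat.
have fz i k : z != (f i k).1.
  apply: (adj_neq H_simple); rewrite -[z]/((z, i).1) -(adj_blowup H).
  by have [_ /(_ k)] := fP i; apply: (fintype.subsetP sG).
pose e (p : 'I_n * 'I_d) := [set (z, p.1); f p.1 p.2].
have inje : injective e.
  move=> [i k] [i' k'] /set2_inj[[[<-] /= /(proj1 (fP i))->]|[/= E _]] //.
  by have := fz i' k'; rewrite -E eqxx.
have /subset_leq_card : [set e p | p in predT] \subset G.
  by apply/fintype.subsetP => _ /imsetP[[i k] _ ->]; have [_ /(_ k)] := fP i.
by rewrite card_imset // card_prod !card_ord.
Qed.

Lemma full_part_bound z :
  (forall i, exists w, forall j, adj G (z, i) (w, j)) -> n ^ 2 <= #|G|.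
Proof.
move=> full; rewrite -mulnn; apply: (@part_degree_bound z) => i.
by have [w wG] := full i; exists (fun j => (w, j)); split=> // j k [].
Qed.

(** Here [S] is a union of components: if both sides could be completed by an
    edge, the two completed halves would make up a copy. *)
Lemma disconnected_bound (S : {set V}) p q :
  no_isolated_vertex H -> (forall u v, adj H u v -> (u \in S) = (v \in S)) ->
  p \in S -> q \notin S -> n ^ 2 <= #|G|.
Proof.
move=> noiso clS pS qS; have [[y py] [y' qy']] := (noiso p, noiso q).
have XY u v : adj H u v ->
    (u \in S) && (v \in S) || (u \in ~: S) && (v \in ~: S).
  by move=> /clS uv; rewrite !inE uv; case: (v \in S).
have yS : y \notin ~: S by rewrite inE negbK -(clS _ _ py).
have y'S : y' \notin S by rewrite -(clS _ _ qy').
have [/forallP full|/forallPn[i /forallPn[j nij]]] :=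
  boolP [forall i, forall j, adj G (p, i) (y, j)].
  by apply: (@full_part_bound p) => i; exists y => j; apply/forallP: j.
apply: (@full_part_bound q) => i'; exists y' => j'.
have := @saturated_gluing S (~: S) p y q y' i j i' j' XY _ py yS qy' y'S.
by rewrite (negPf nij); apply=> w wS; rewrite inE wS.
Qed.

(** Now the two sides share the cut vertex [z]. Each single vertex [(z, i)]
    must be joined to a whole part on one of the two sides, since otherwise it
    would be the common root of two completed halves. *)
Lemma cut_vertex_bound (S : {set V}) z a b :
  (forall u v, u != z -> v != z -> adj H u v -> (u \in S) = (v \in S)) ->
  z \notin S -> adj H z a -> a \in S -> adj H z b -> b \notin S ->
  n ^ 2 <= #|G|.
Proof.
move=> clS zS za aS zb bS; have nbz := adj_neq H_simple zb.
have XY u v : adj H u v ->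
    (u \in z |: S) && (v \in z |: S) || (u \in ~: S) && (v \in ~: S).
  move=> uv; rewrite !inE; have [->|uz] := eqVneq u z.
    by rewrite zS; case: (v \in S); rewrite ?orbT.
  have [->|vz] := eqVneq v z; first by rewrite zS; case: (u \in S); rewrite ?orbT.
  by rewrite (clS u v) //; case: (v \in S); rewrite ?orbT.
apply: (@full_part_bound z) => i.
have [/forallP full|/forallPn[j nij]] := boolP [forall j, adj G (z, i) (a, j)].
  by exists a.
exists b => j'; have := @saturated_gluing (z |: S) (~: S) z a z b i j i j' XY.
rewrite (negPf nij); apply=> // [w||].
- by rewrite !inE => /orP[/eqP->|->].
- by rewrite inE aS.
- by rewrite !inE eq_sym (negPf nbz).
Qed.

(** If the removal of [z] separates [p] from [q], let [S] be the component of
    [p]. Either [z] has neighbours both in [S] and outside, or one of [S] and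
    [z |: S] is closed under adjacency. *)
Lemma not_two_connected_bound :
  no_isolated_vertex H -> ~~ two_connected H -> n ^ 2 <= #|G|.
Proof.
move=> noiso /forallPn[z /forall_inPn[p pz /forall_inPn[q qz npq]]].
rewrite !inE in pz qz; set e := adj (delete_vertex H z) in npq.
pose S := [set w | connect e p w].
have pS : p \in S by rewrite inE connect0.
have qS : q \notin S by rewrite inE.
have clS u v : u != z -> v != z -> adj H u v -> (u \in S) = (v \in S).
  move=> uz vz uv; have euv : e u v.
    by rewrite /e adj_delete uv ![z == _]eq_sym uz vz.
  rewrite !inE; apply/idP/idP => pc.
    by apply: connect_trans pc (connect1 _).
  by apply: connect_trans pc (connect1 _); rewrite /e adj_sym.
have zS : z \notin S.
  rewrite inE; apply/negP => /(@closed_connect _ _ (predC1 z)) cl.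
  have: (p \in predC1 z) = (z \in predC1 z).
    apply: cl => u v; rewrite /e adj_delete => /and3P[_ uz vz].
    by rewrite !inE ![_ == z]eq_sym uz vz.
  by rewrite !inE pz eqxx.
have [/existsP[a /andP[za aS]]|/existsPn nza] :=
    boolP [exists a, adj H z a && (a \in S)]; last first.
  apply: (disconnected_bound noiso _ pS qS) => u v uv.
  have [ez|uz] := eqVneq u z.
    by have := nza v; rewrite -{1}ez uv /= ez (negPf zS) => /negPf->.
  have [ez|vz] := eqVneq v z.
    by have := nza u; rewrite -{1}ez adj_sym uv /= ez (negPf zS) => /negPf->.
  exact: clS.
have [/existsP[b /andP[zb bS]]|/existsPn nzb] :=
    boolP [exists b, adj H z b && (b \notin S)].
  exact: cut_vertex_bound clS zS za aS zb bS.
apply: (@disconnected_bound (z |: S) p q noiso) => [u v uv||]; last 2 first.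
- by rewrite in_setU1 pS orbT.
- by rewrite in_setU1 negb_or qz.
rewrite !in_setU1; have [ez|uz] := eqVneq u z.
  by have := nzb v; rewrite -{1}ez uv /= negbK => ->; rewrite orbT.
have [ez|vz] := eqVneq v z.
  by have := nzb u; rewrite -{1}ez adj_sym uv /= negbK => ->.
exact: clS.
Qed.

(** If [w] were the only neighbour of [v], deleting [w] would isolate [v], and
    connectedness would leave no vertex besides [v] and [w]. *)
Lemma two_connected_degree : 2 <= #|H| -> two_connected H ->
  forall v w, adj H v w -> exists2 u, adj H v u & u != w.
Proof.
move=> H2 /forallP/[swap] v /[swap] w /(_ w) con vw.
apply: contrapT => nu; have only u : adj H v u -> u = w.
  by move=> vu; apply: contrapT => /eqP uw; apply: nu; exists u.
have all u : u != w -> u = v.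
  move=> uw; apply/eqP; have vw' := adj_neq H_simple vw.
  have /forall_inP/(_ v) := con; rewrite !inE vw' => /(_ isT)/forall_inP/(_ u).
  rewrite !inE uw => /(_ isT)/(@closed_connect _ _ (pred1 v)) cl.
  have: (v \in pred1 v) = (u \in pred1 v); last by rewrite !inE eqxx.
  apply: cl => a b; rewrite adj_delete => /and3P[ab wa wb]; rewrite !inE.
  apply/eqP/eqP => ev; move: ab; rewrite ev => /[dup].
    by move=> /only eb; rewrite eb eqxx in wb.
  by rewrite adj_sym => /only ea; rewrite ea eqxx in wa.
have : H \subset [set [set v; w]].
  apply/fintype.subsetP => _ /(adj_edge H_simple)[a [b [-> ab]]].
  rewrite inE; have := adj_neq H_simple ab.
  have [->|/all->] := eqVneq a w; have [->|/all->] := eqVneq b w; rewrite ?eqxx //.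
  by rewrite finset.setUC eqxx.
by move/subset_leq_card; rewrite cards1 leqNgt H2.
Qed.

(** An isolated vertex [(v, i)] of [G] would have degree one in the copy
    created by an edge at it, but every degree in [H] is at least two. *)
Lemma two_connected_bound : no_isolated_vertex H -> 2 <= #|H| ->
  two_connected H -> n <= #|G|.
Proof.
move=> noiso H2 con.
have [A AH] : exists A, A \in H by apply/card_gt0P; apply: leq_trans H2.
have [v [w [_ vw]]] := adj_edge H_simple AH.
have [u vu uw] := two_connected_degree H2 con vw.
rewrite -[X in X <= _]muln1; apply: (@part_degree_bound v) => i.
have [vG|/(saturated_missing vw)[t [tv _ tG]]] := boolP (adj G (v, i) (w, i)).
  by exists (fun=> (w, i)); split=> // j k _; rewrite !ord1.
exists (fun=> (u, t u)); split=> [j k _|_]; first by rewrite !ord1.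
rewrite -tv; apply: tG => //; apply: contraNneq uw => /set2_inj[[_ ->]|[-> ->]] //.
Qed.

End Saturated.

(** * A sparse graph that is almost saturated in a 2-connected blow-up *)

Section Gadget.

Variables (V : finType) (H : {set {set V}}) (n : nat).
Hypothesis H_simple : simple_graph H.

Let core := #|{: {set V}}|.

(** The layers are numbered by all subsets of [V], not only by the edges of
    [H]: their number is still a constant, and the numbering is total. *)
Definition edge_index (e : {set V}) : nat := enum_rank e.

(** The vertices of the piece of the gadget belonging to [e]: over the ends of
    [e] these are all the outer vertices, over any other vertex of [H] the
    single one in the layer of [e]. *)
Definition attached (e : {set V}) (p : V * 'I_n) : bool :=
  if p.1 \in e then core <= p.2 else p.2 == edge_index e :> nat.

(** The piece of [e] spans all edges of the blow-up except those over [e]. *)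
Definition gadget_rel (p q : V * 'I_n) : bool :=
  adj H p.1 q.1 &&
  [exists e in H, [&& attached e p, attached e q & e != [set p.1; q.1]]].

Definition gadget : {set {set V * 'I_n}} :=
  [set [set a.1; a.2] | a in [pred a : _ * _ | gadget_rel a.1 a.2]].

Lemma edge_index_lt e : edge_index e < core.
Proof. exact: ltn_ord. Qed.

Lemma edge_index_inj : injective edge_index.
Proof. by move=> e e' /val_inj/enum_rank_inj. Qed.

Lemma adj_gadget p q : adj gadget p q = gadget_rel p q.
Proof.
have gsym a b : gadget_rel a b = gadget_rel b a.
  rewrite /gadget_rel adj_sym finset.setUC; congr (_ && _).
  by apply: eq_existsb => e; congr (_ && _); rewrite andbCA.
rewrite adjE; apply/imsetP/idP => [[[a b] /= ab /set2_inj[]]|pq].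
- by case=> -> ->.
- by case=> -> ->; rewrite gsym.
- by exists (p, q).
Qed.

Lemma gadget_sub : gadget \subset blowup H n.
Proof.
apply/fintype.subsetP => _ /imsetP[[a b] /= /andP[ab _] ->].
by rewrite -adjE adj_blowup.
Qed.

Lemma adj_mem2 e x y : e \in H -> adj H x y -> x \in e -> y \in e ->
  e = [set x; y].
Proof.
move=> eH xy xe ye; apply/esym/eqP.
rewrite eqEcard (H_simple eH) cards2 (adj_neq H_simple xy) andbT.
by rewrite finset.subUset !finset.sub1set xe.
Qed.

(** Take a layer [e = xy] that the copy [t] visits, and the class of the
    vertices placed in it. Neighbours of the class are in the class, or are
    outer ends of [e]. If [x] were not outer, the class would be closed under
    adjacency in [H - y], although it omits [x]; so [x] is outer, and [y] by
    symmetry, contradicting that outer vertices are independent. *)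
Lemma gadget_free : no_isolated_vertex H -> 0 < #|H| -> two_connected H ->
  partite_free H gadget.
Proof.
move=> noiso /card_gt0P[A AH] con; apply/(partite_freeP H_simple gadget_sub).
move=> t tG.
have step u v : adj H u v -> exists e, [/\ e \in H, attached e (u, t u),
    attached e (v, t v) & ~~ ((u \in e) && (v \in e))].
  move=> uv; have := tG u v uv; rewrite adj_gadget => /andP[_ /exists_inP[e eH]].
  case/and3P=> eu ev /eqP/= ne; exists e; split=> //.
  by apply/negP => /andP[ue ve]; apply: ne; apply: adj_mem2.
have attP e w : attached e (w, t w) -> w \notin e -> t w = edge_index e :> nat.
  by rewrite /attached /= => /[swap]/negPf-> /eqP.
have outer e w : attached e (w, t w) -> w \in e -> core <= t w.
  by rewrite /attached /= => /[swap]->.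
have indep u v : adj H u v -> core <= t u -> core <= t v -> False.
  move=> /step[e [_ eu ev ne]] cu cv; case/negP: ne; apply/andP; split.
    by apply: contraLR cu => /(attP _ _ eu)->; rewrite -ltnNge edge_index_lt.
  by apply: contraLR cv => /(attP _ _ ev)->; rewrite -ltnNge edge_index_lt.
have classP e u v : t u = edge_index e :> nat -> adj H u v ->
    u \notin e /\ (t v = edge_index e :> nat \/ core <= t v /\ v \in e).
  move=> tu /step[e' [_ eu ev _]].
  have ue' : u \notin e'.
    by apply/negP => /(outer _ _ eu); rewrite tu leqNgt edge_index_lt.
  have ee' : e' = e by apply: edge_index_inj; rewrite -tu (attP _ _ eu).
  rewrite ee' in ue' ev; split=> //; have [ve|ve] := boolP (v \in e).
    by right; split=> //; apply: outer ve.
  by left; apply: attP.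
have [c [e [eH tc]]] : exists c e, e \in H /\ t c = edge_index e :> nat.
  have [a [b [_ /step[e [eH ea eb]]]]] := adj_edge H_simple AH.
  rewrite negb_and => /orP[ae|be]; [exists a, e|exists b, e]; split=> //.
    exact: attP.
  exact: attP.
have notin w : t w = edge_index e :> nat -> w \notin e.
  by move=> tw; have [v /(classP _ _ _ tw)[]] := noiso w.
have [x [y [exy xy]]] := adj_edge H_simple eH.
(* Deleting [y'] leaves [x'] as the only exit from the class of [c]. *)
have ends x' y' : e = [set x'; y'] -> x' != y' -> core <= t x'.
  move=> exy' nxy; rewrite leqNgt; apply/negP => inx.
  have xe : x' \in e by rewrite exy' set21.
  have ye : y' \in e by rewrite exy' set22.
  have cy : c != y' by apply: contraTneq ye => <-; apply: notin.
  have /forallP/(_ y')/forall_inP/(_ c) := con; rewrite !inE cy.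
  move=> /(_ isT)/forall_inP/(_ x'); rewrite !inE nxy => /(_ isT).
  pose C := [pred w | t w == edge_index e :> nat].
  move=> /(@closed_connect _ _ C) cl.
  have : (c \in C) = (x' \in C); last first.
    by rewrite !inE tc eqxx => /esym/eqP/notin; rewrite xe.
  apply: cl => {}u v; rewrite adj_delete => /and3P[uv yu yv].
  have half a b : adj H a b -> y' != b -> a \in C -> b \in C.
    rewrite !inE => ab yb /eqP/classP/(_ ab)[_ [->//|[ob]]].
    rewrite exy' => /set2P[eb|eb]; last by rewrite eb eqxx in yb.
    by move: ob; rewrite eb leqNgt inx.
  by apply/idP/idP; apply: half => //; rewrite adj_sym.
apply: (indep _ _ xy); have nxy := adj_neq H_simple xy; first exact: ends exy nxy.
by apply: (ends y x); rewrite 1?eq_sym // exy finset.setUC.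
Qed.

(** An outer edge over [e = xy] completes the piece of [e] to a copy of [H]. *)
Lemma gadget_outer_edge (G : {set {set V * 'I_n}}) x y i j :
  core <= n -> gadget \subset G -> G \subset blowup H n -> partite_free H G ->
  adj G (x, i) (y, j) -> core <= i -> core <= j -> False.
Proof.
move=> cn gG sG fG ij ci cj.
have xy : adj H x y.
  by rewrite -[x]/((x, i).1) -[y]/((y, j).1) -(adj_blowup H) adjE; apply: (fintype.subsetP sG).
pose e := [set x; y].
have en : edge_index e < n by apply: leq_trans (edge_index_lt e) cn.
pose t w := if w == x then i else if w == y then j else Ordinal en.
have att w : attached e (w, t w).
  rewrite /attached /t /= !inE; have [_|wx] := eqVneq w x => //=.
  by have [_|wy] := eqVneq w y => /=.
apply: (partite_freeP H_simple sG fG t) => u v uv.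
have [/esym/set2_inj[[-> ->]|[-> ->]]|nuv] := eqVneq e [set u; v].
- by rewrite /t !eqxx eq_sym (negPf (adj_neq H_simple xy)).
- by rewrite adj_sym /t !eqxx eq_sym (negPf (adj_neq H_simple xy)).
apply: (fintype.subsetP gG); rewrite -adjE adj_gadget /gadget_rel uv /=.
by apply/existsP; exists e; rewrite -adjE xy !att.
Qed.

Lemma inner_edges_bound (G : {set {set V * 'I_n}}) :
  core <= n -> G \subset blowup H n ->
  (forall x y i j, adj G (x, i) (y, j) -> core <= i -> core <= j -> False) ->
  #|G| <= (#|V| * core * #|V|) * n.
Proof.
move=> cn sG inner.
pose f (a : (V * 'I_core) * (V * 'I_n)) := [set (a.1.1, widen_ord cn a.1.2); a.2].
have /subset_leq_card : G \subset [set f a | a in predT].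
  apply/fintype.subsetP => A AG.
  have /imset2P[[x i] [y j] _ _ eA] := fintype.subsetP sG _ AG.
  have ij : adj G (x, i) (y, j) by rewrite adjE -eA.
  have [ci|/(inner _ _ _ _ ij) ci] := ltnP i core.
    apply/imsetP; exists ((x, Ordinal ci), (y, j)) => //.
    by rewrite eA /f /=; congr [set (_, _); _]; apply: val_inj.
  have [cj|//] := ltnP j core.
  apply/imsetP; exists ((y, Ordinal cj), (x, i)) => //.
  by rewrite eA finset.setUC /f /=; congr [set (_, _); _]; apply: val_inj.
move/leq_trans; apply; apply: leq_trans (leq_imset_card _ _) _.
by rewrite !card_prod !card_ord !mulnA.
Qed.

End Gadget.

(** * Asymptotics *)

Lemma sat_p_linear_upper (V : finType) (H : {set {set V}}) n :
  simple_graph H -> no_isolated_vertex H -> 0 < #|H| -> two_connected H ->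
  #|{: {set V}}| <= n ->
  sat_p H n <= (#|V| * #|{: {set V}}| * #|V|) * n.
Proof.
move=> sH noiso H0 con cn.
have [G satG gG] := saturated_extension (gadget_sub H n)
  (gadget_free n sH noiso H0 con).
have /and3P[sG fG _] := satG.
apply: leq_trans (sat_p_le satG) _; apply: inner_edges_bound (sG) _ => // x y i j.
exact: gadget_outer_edge fG.
Qed.

Local Open Scope classical_set_scope.
Local Open Scope ring_scope.

Lemma eqTheta_nat (R : realType) (f g : nat -> nat) c N :
  (forall n, (N <= n)%N -> (g n <= f n <= c * g n)%N) ->
  (fun n : nat => (f n)%:R : R^o) =Theta_\oo (fun n : nat => (g n)%:R : R^o).
Proof.
move=> fg; rewrite eqThetaE bigThetaE; split; last rewrite eqOmegaO.
  apply/eqOP; near=> k; near=> n; rewrite !ger0_norm ?ler0n //.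
  have /andP[_ le] : (g n <= f n <= c * g n)%N.
    by apply: fg; near: n; apply: nbhs_infty_ge.
  apply: (@le_trans _ _ (c%:R * (g n)%:R)); first by rewrite -natrM ler_nat.
  by apply: ler_wpM2r; rewrite ?ler0n //; near: k; apply: nbhs_pinfty_ge.
apply/eqOP; near=> k; near=> n; rewrite !ger0_norm ?ler0n //.
have /andP[le _] : (g n <= f n <= c * g n)%N.
  by apply: fg; near: n; apply: nbhs_infty_ge.
apply: (@le_trans _ _ (1 * (f n)%:R)); first by rewrite mul1r ler_nat.
by apply: ler_wpM2r; rewrite ?ler0n //; near: k; apply: nbhs_pinfty_ge.
Unshelve. all: by end_near. Qed.

Theorem theorem12 (R : realType) (V : finType) (H : {set {set V}})
    (H_simple : simple_graph H) (H_edges : (2 <= #|H|)%N)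
    (H_noiso : no_isolated_vertex H) :
  (two_connected H ->
    (fun n : nat => (sat_p H n)%:R : R^o) =Theta_\oo (fun n : nat => n%:R : R^o))
  /\
  (~ two_connected H ->
    (fun n : nat => (sat_p H n)%:R : R^o) =Theta_\oo
    (fun n : nat => (n ^ 2)%:R : R^o)).
Proof.
have H0 : (0 < #|H|)%N by apply: leq_trans H_edges.
split=> [con|/negP ncon].
  apply: (@eqTheta_nat R (sat_p H) id
            (#|V| * #|{: {set V}}| * #|V|) #|{: {set V}}|) => n cn.
  rewrite sat_p_linear_upper // andbT.
  have [[G satG <-] _] := sat_pP n H_simple H0.
  exact: two_connected_bound satG _ _ _.
apply: (@eqTheta_nat R (sat_p H) (fun n => n ^ 2)%N (#|V| ^ 2) 0) => n _.
have [[G satG <-] _] := sat_pP n H_simple H0.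
rewrite (not_two_connected_bound H_simple satG) //=.
have /and3P[sG _ _] := satG.
exact: leq_trans (subset_leq_card sG) (card_blowup H n).
Qed.
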